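(* Let $c\in(0,1)$ and let $(G_n)_{n\in\mathbb{N}}$ be a sequence of random directed graphs, where $G_n$ has vertex set $[n]=\{1,\dots,n\}$. Let $\boldsymbol{R}(n)=(R_1(n),\dots,R_n(n))$ be the graph-normalized PageRank vector of $G_n$ with damping factor $c$, and let $V_n$ be a uniformly chosen vertex of $G_n$. Then the following hold: (a) If $G_n$ converges in distribution in the (directed) local weak sense, then there exists a limiting random variable $R_\varnothing$ with $\mathbb{E}[R_\varnothing]\le 1$ such that $$R_{V_n}(n)\stackrel{d}{\longrightarrow}R_\varnothing\qquad (n\to\infty).$$ (b) If $G_n$ converges in probability in the (directed) local weak sense, then there exists a limiting random variable $R_\varnothing$ with $\mathbb{E}[R_\varnothing]\le 1$ such that, for every $r>0$, $$\frac1n\sum_{i\in[n]}\mathbf{1}\{R_i(n)>r\}\stackrel{\mathbb{P}}{\longrightarrow}\mathbb{P}(R_\varnothing>r)\qquad (n\to\infty).$$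
   Context: PageRank. For a finite directed multigraph on $[n]$, let $e_{j,i}$ be the number of directed edges from $j$ to $i$, and $d^{(\mathrm{in})}_i$, $d^{(\mathrm{out})}_i$ the in- and out-degree of $i$. The graph-normalized PageRank with damping factor $c\in(0,1)$ is the unique solution $\boldsymbol{R}(n)$ of $$R_i(n)=c\sum_{j\in[n]}\frac{e_{j,i}}{d^{(\mathrm{out})}_j}R_j(n)+(1-c),\qquad i\in[n],$$ where terms with $d^{(\mathrm{out})}_j=0$ (hence $e_{j,i}=0$) are read as $0$. The vertex $V_n$ is uniform on $[n]$ given $G_n$. Rooted marked directed graphs. A rooted marked directed graph is a triple $(G,\varnothing,M(G))$, where $G$ is a directed multigraph (self-loops and multiple edges allowed) with finite or countable vertex set $V(G)$ and finite in- and out-degrees, $\varnothing\in V(G)$ is the root, and $M(G)=(m^{(\mathrm{out})}_i)_{i\in V(G)}$ are integers (marks) with $d^{(\mathrm{out})}_i\le m^{(\mathrm{out})}_i<\infty$. Two such objects are isomorphic ($\cong$) if there is a bijection of the vertex sets that preserves directed edges (with multiplicity), the root and the marks. For $k\ge0$, the $k$-neighborhood $U_{\le k}(\varnothing)$ is the rooted marked directed graph consisting of all vertices from which there is a directed path of length at most $k$ to $\varnothing$, all edges of $G$ between these vertices (for $k=0$: only $\varnothing$, no edges), root $\varnothing$, and marks inherited from $(G,\varnothing,M(G))$. Let $\mathcal{G}_\star$ be the set of isomorphism classes, and set $d_{loc}((G,\varnothing,M(G)),(G',\varnothing',M(G')))=1/(1+\kappa)$, where $\kappa=\inf\{k\ge1: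 U_{\le k}(\varnothing)\not\cong U_{\le k}(\varnothing')\}$ (distance $0$ if $\kappa=\infty$). This is a pseudometric; let $\tilde{\mathcal{G}}_\star$ be the quotient of $\mathcal{G}_\star$ identifying elements at distance $0$, on which $d_{loc}$ is a metric. Directed local weak (LW) convergence. For a finite marked directed graph $G_n$ put $\mathcal{P}_n=\frac{1}{|V(G_n)|}\sum_{i\in V(G_n)}\delta_{(G_n,i,M(G_n))}$, a probability on $\tilde{\mathcal{G}}_\star$. An unmarked directed graph is given marks equal to its out-degrees. For a sequence of random $G_n$ and a probability $\mathcal{P}$ on $\tilde{\mathcal{G}}_\star$, $G_n$ converges to $\mathcal{P}$ in the LW sense: in distribution if $\mathbb{E}[\mathbb{E}_{\mathcal{P}_n}[f]]\to\mathbb{E}_{\mathcal{P}}[f]$; in probability if $\mathbb{E}_{\mathcal{P}_n}[f]\to\mathbb{E}_{\mathcal{P}}[f]$ in probability; in each case for every bounded continuous $f:\tilde{\mathcal{G}}_\star\to\mathbb{R}$. ''$G_n$ converges'' means that it converges to some probability $\mathcal{P}$ on $\tilde{\mathcal{G}}_\star$.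
   Formalization: In (b), ''for every r>0'' is replaced by ''for every r>0 at which the distribution function of R_∅ is continuous'', since at an atom of R_∅ the proportion need not converge (e.g. directed cycles for odd n, paths fed by extra sources for even n, r=1). *)

(* Defs.v *)
From HB Require Import structures.
From mathcomp Require Import all_boot all_order all_algebra finmap.
From mathcomp Require Import all_classical all_reals all_analysis.

Set Implicit Arguments.
Unset Strict Implicit.
Unset Printing Implicit Defensive.

Import Order.TTheory GRing.Theory Num.Theory.
Import numFieldNormedType.Exports.

Local Open Scope classical_set_scope.
Local Open Scope ring_scope.
Local Open Scope quotient_scope.

(* In an edge multiplicity function e, the number of edges from j to i
   is e j i. *)
Definition outdeg (e : nat -> nat -> nat) (i : nat) : nat :=
  \big[addn/0%N]_(j \in [set: nat]) e i j.

Lemma outdegE (e : nat -> nat -> nat) i :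
  finite_set [set j | e i j != 0%N] ->
  outdeg e i = (\sum_(j <- fset_set [set j | e i j != 0%N]) e i j)%N.
Proof.
move=> fe; rewrite -(fsbig_finite _ _ fe) /outdeg; apply/esym.
by apply: fsbig_widen => // j [_ /= /negP]; rewrite negbK => /eqP.
Qed.

Lemma outdeg_le (e e' : nat -> nat -> nat) i :
    finite_set [set j | e' i j != 0%N] -> (forall j, e i j <= e' i j)%N ->
  (outdeg e i <= outdeg e' i)%N.
Proof.
move=> fe' ee'.
have sub : [set j | e i j != 0%N] `<=` [set j | e' i j != 0%N].
  by move=> j /=; rewrite -!lt0n => /leq_trans; apply.
have fe := sub_finite_set sub fe'.
rewrite (outdegE fe) (outdegE fe').
set s := enum_fset (fset_set _); set s' := enum_fset (fset_set _).
apply: (@leq_trans (\sum_(j <- s) e' i j)%N); first exact: leq_sum.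
apply: (@uniq_sub_le_big _ addn leq).
- exact: leqnn.
- by move=> x y; exact: leq_addr.
- exact: fset_uniq.
- exact: fset_uniq.
- by move=> j; rewrite !in_fset_set// !inE; exact: sub.
Qed.

(* Every finite or countable vertex set is in bijection with a set of natural
   numbers, so that every isomorphism class has a representative of the
   following form.  Only the marks of vertices matter. *)
Record rmgraph := RMGraph {
  rmg_vert : set nat;
  rmg_edge : nat -> nat -> nat;
  rmg_root : nat;
  rmg_mark : nat -> nat;
  rmg_root_vert : rmg_vert rmg_root;
  rmg_edge_vert : forall i j,
    rmg_edge i j != 0%N -> rmg_vert i /\ rmg_vert j;
  rmg_fin_out : forall i, finite_set [set j | rmg_edge i j != 0%N];
  rmg_fin_in : forall i, finite_set [set j | rmg_edge j i != 0%N];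
  rmg_outdeg_le : forall i,
    rmg_vert i -> (outdeg rmg_edge i <= rmg_mark i)%N }.

Definition rmg_iso (G H : rmgraph) : Prop :=
  exists phi : nat -> nat,
    [/\ set_bij (rmg_vert G) (rmg_vert H) phi,
        forall i j, rmg_vert G i -> rmg_vert G j ->
          rmg_edge H (phi i) (phi j) = rmg_edge G i j,
        phi (rmg_root G) = rmg_root H &
        forall i, rmg_vert G i -> rmg_mark H (phi i) = rmg_mark G i].

Section neighborhood.
Variables (G : rmgraph) (k : nat).
Local Notation e := (rmg_edge G).

Definition nbhd_vert : set nat := [set x | exists p : seq nat,
  [/\ path (fun i j => 0 < e i j)%N x p, last x p = rmg_root G &
      (size p <= k)%N]].

Definition nbhd_edge (i j : nat) : nat :=
  if [&& (0 < k)%N, i \in nbhd_vert & j \in nbhd_vert] then e i j else 0%N.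

Lemma nbhd_root_vert : nbhd_vert (rmg_root G).
Proof. by exists [::]. Qed.

Lemma nbhd_edge_vert i j : nbhd_edge i j != 0%N -> nbhd_vert i /\ nbhd_vert j.
Proof. by rewrite /nbhd_edge; case: ifP => // /and3P[_ /set_mem ? /set_mem]. Qed.

Lemma nbhd_edge_le i j : (nbhd_edge i j <= e i j)%N.
Proof. by rewrite /nbhd_edge; case: ifP. Qed.

Lemma nbhd_fin_out i : finite_set [set j | nbhd_edge i j != 0%N].
Proof.
apply: (sub_finite_set _ (rmg_fin_out G i)) => j /=.
by rewrite -!lt0n => /leq_trans -> //; exact: nbhd_edge_le.
Qed.

Lemma nbhd_fin_in i : finite_set [set j | nbhd_edge j i != 0%N].
Proof.
apply: (sub_finite_set _ (rmg_fin_in G i)) => j /=.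
by rewrite -!lt0n => /leq_trans -> //; exact: nbhd_edge_le.
Qed.

Lemma nbhd_vert_sub : nbhd_vert `<=` rmg_vert G.
Proof.
move=> x [[|y p] /= [+ + _]]; first by move=> _ ->; exact: rmg_root_vert.
by rewrite lt0n => /andP[/rmg_edge_vert[]].
Qed.

Lemma nbhd_outdeg_le i : nbhd_vert i ->
  (outdeg nbhd_edge i <= rmg_mark G i)%N.
Proof.
move=> /nbhd_vert_sub /rmg_outdeg_le; apply: leq_trans.
by apply: outdeg_le; [exact: rmg_fin_out|exact: nbhd_edge_le].
Qed.

Definition nbhd : rmgraph :=
  @RMGraph nbhd_vert nbhd_edge (rmg_root G) (rmg_mark G) nbhd_root_vert
    nbhd_edge_vert nbhd_fin_out nbhd_fin_in nbhd_outdeg_le.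

End neighborhood.

Lemma rmg_iso_refl G : rmg_iso G G.
Proof. by exists id; split => //; split => // x; exists x. Qed.

Lemma rmg_iso_sym G H : rmg_iso G H -> rmg_iso H G.
Proof.
move=> [f [bf fe fr fm]].
pose g := pinv (rmg_vert G) f.
have bg : set_bij (rmg_vert H) (rmg_vert G) g by exact: bijpinv_bij.
have gK i : rmg_vert H i -> f (g i) = i.
  by case: bf => _ _ surf /mem_set Hi; exact: (@surjpK _ _ (fun=> point) _ _ _ surf i Hi).
have gf i : rmg_vert H i -> rmg_vert G (g i).
  by case: bg => fg _ _; exact: fg.
exists g; split => //.
- by move=> i j Hi Hj; rewrite -fe ?gK//; exact: gf.
- case: bf => _ injf _; apply: injf; rewrite ?inE.
  + by apply: gf; exact: rmg_root_vert.
  + exact: rmg_root_vert.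
  + by rewrite gK ?fr//; exact: rmg_root_vert.
- by move=> i Hi; rewrite -fm ?gK//; exact: gf.
Qed.

Lemma rmg_iso_trans H G K : rmg_iso G H -> rmg_iso H K -> rmg_iso G K.
Proof.
move=> [f [bf fe fr fm]] [g [bg ge gr gm]].
have fV i : rmg_vert G i -> rmg_vert H (f i) by case: bf => ff _ _; exact: ff.
exists (g \o f); split => /=.
- exact: set_bij_comp bf bg.
- by move=> i j Gi Gj; rewrite ge ?fe//; exact: fV.
- by rewrite fr gr.
- by move=> i Gi; rewrite gm ?fm//; exact: fV.
Qed.

Definition nbhd_differ (G H : rmgraph) : pred nat :=
  fun k => `[< (1 <= k)%N /\ ~ rmg_iso (nbhd G k) (nbhd H k) >].

(* The infimum of nbhd_differ G H is finite exactly when the set is inhabited,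
   and is then its least element. *)
Definition dloc (R : numFieldType) (G H : rmgraph) : R :=
  if pselect (exists k, nbhd_differ G H k) is left ex
  then (1 + (ex_minn ex)%:R)^-1 else 0.

Section dloc_theory.
Variable R : numFieldType.
Local Notation dloc := (dloc R).

Lemma dloc_eq0 G H : dloc G H = 0 <-> forall k, ~~ nbhd_differ G H k.
Proof.
rewrite /dloc; case: pselect => [ex|nex]; split => //.
- move=> /eqP; rewrite invr_eq0 gt_eqF// ltr_wpDr ?ler0n//.
- by case: ex => k dk /(_ k); rewrite dk.
- by move=> _ k; apply/negP => dk; apply: nex; exists k.
Qed.

Lemma dlocxx G : dloc G G = 0.
Proof.
by apply/dloc_eq0 => k; apply/negP => /asboolP[_]; apply; exact: rmg_iso_refl.
Qed.

Lemma dloc_ge0 G H : 0 <= dloc G H.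
Proof.
by rewrite /dloc; case: pselect.
Qed.

Lemma nbhd_differC G H : nbhd_differ G H = nbhd_differ H G.
Proof.
apply/funext => k; apply/idP/idP => /asboolP[k1 niso]; apply/asboolP;
  by split => // /rmg_iso_sym.
Qed.

Lemma dlocC G H : dloc G H = dloc H G.
Proof. by rewrite /dloc nbhd_differC. Qed.

Lemma nbhd_differ_trans H G K k :
  nbhd_differ G K k -> nbhd_differ G H k || nbhd_differ H K k.
Proof.
move=> /asboolP[k1 nGK]; apply/negPn; rewrite negb_or; apply/negP => /andP[].
move=> /asboolPn nGH /asboolPn nHK; apply: nGK; apply: (@rmg_iso_trans (nbhd H k)).
  by apply: contrapT => ?; apply: nGH.
by apply: contrapT => ?; apply: nHK.
Qed.

Lemma dloc_triangle H G K : dloc G K <= dloc G H + dloc H K.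
Proof.
rewrite {1}/dloc; case: pselect => [ex|_]; last by rewrite addr_ge0// dloc_ge0.
case: ex_minnP => m dm mmin.
suff dge A B : nbhd_differ A B m -> (1 + m%:R)^-1 <= dloc A B.
  have /orP[/dge mGH|/dge mHK] := nbhd_differ_trans H dm.
    by rewrite (le_trans mGH)// lerDl dloc_ge0.
  by rewrite (le_trans mHK)// lerDr dloc_ge0.
move=> dAB; rewrite /dloc; case: pselect => [ex'|[]]; last by exists m.
case: ex_minnP => p _ /(_ _ dAB) pm.
by rewrite lef_pV2 ?posrE ?ltr_wpDr ?ler0n// lerD2l ler_nat.
Qed.

End dloc_theory.

HB.instance Definition _ := gen_eqMixin rmgraph.
HB.instance Definition _ := gen_choiceMixin rmgraph.

(* Isomorphic graphs are at distance 0, so that quotienting by isomorphism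
   first would make no difference. *)
Section lwspace.
Variable R : realType.

Definition dloc0 (G H : rmgraph) : bool := dloc R G H == 0.

Lemma dloc0_refl : reflexive dloc0.
Proof. by move=> G; rewrite /dloc0 dlocxx. Qed.

Lemma dloc0_sym : symmetric dloc0.
Proof. by move=> G H; rewrite /dloc0 dlocC. Qed.

Lemma dloc0_trans : transitive dloc0.
Proof.
move=> H G K /eqP GH /eqP HK; rewrite /dloc0 eq_le dloc_ge0 andbT.
by rewrite (le_trans (dloc_triangle R H G K))// GH HK addr0.
Qed.

Definition dloc0_equiv := EquivRel dloc0 dloc0_refl dloc0_sym dloc0_trans.

Definition lwspace : Type := {eq_quot dloc0_equiv}.

HB.instance Definition _ := Choice.on lwspace.

Definition lwclass (G : rmgraph) : lwspace := \pi_{eq_quot dloc0_equiv} G.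

Definition lwrepr (x : lwspace) : rmgraph := repr (x : {eq_quot dloc0_equiv}).

Lemma lwreprK x : lwclass (lwrepr x) = x.
Proof. exact: reprK. Qed.

Lemma lwclassP G H : lwclass G = lwclass H <-> dloc R G H = 0.
Proof.
by split => [/eqquotP/eqP //|/eqP GH]; apply/eqquotP.
Qed.

Definition lwdist (x y : lwspace) : R := dloc R (lwrepr x) (lwrepr y).

Lemma lwdist_class G H : lwdist (lwclass G) (lwclass H) = dloc R G H.
Proof.
have dr K : dloc R (lwrepr (lwclass K)) K = 0 by apply/lwclassP; rewrite lwreprK.
rewrite /lwdist; apply/eqP; rewrite eq_le; apply/andP; split.
  rewrite (le_trans (dloc_triangle R G _ _))// dr add0r.
  by rewrite (le_trans (dloc_triangle R H _ _))// (dlocC _ H) dr addr0.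
rewrite (le_trans (dloc_triangle R (lwrepr (lwclass G)) _ _))//.
rewrite (dlocC _ G) dr add0r.
by rewrite (le_trans (dloc_triangle R (lwrepr (lwclass H)) _ _))// dr addr0.
Qed.

Lemma lwdistxx x : lwdist x x = 0.
Proof. exact: dlocxx. Qed.

Lemma lwdist_positivity x y : lwdist x y = 0 -> x = y.
Proof. by move/lwclassP; rewrite !lwreprK. Qed.

Lemma lwdistC x y : lwdist x y = lwdist y x.
Proof. exact: dlocC. Qed.

Lemma lwdist_triangle y x z : lwdist x z <= lwdist x y + lwdist y z.
Proof. exact: dloc_triangle. Qed.

HB.instance Definition _ :=
  isMetric.Build R lwspace lwdistxx lwdist_positivity lwdistC lwdist_triangle.

End lwspace.

(* A directed multigraph on n vertices is the matrix e of its edge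
   multiplicities, with e j i the number of edges from j to i. *)
Section finite_graph.
Variables (n : nat) (e : 'M[nat]_n).

Definition mx_edge (j i : nat) : nat :=
  match insub j : option 'I_n, insub i : option 'I_n with
  | Some j', Some i' => e j' i'
  | _, _ => 0%N
  end.

Lemma mx_edge_ord (j i : 'I_n) : mx_edge j i = e j i.
Proof. by rewrite /mx_edge !valK. Qed.

Lemma mx_edge_vert i j : mx_edge i j != 0%N -> `I_n i /\ `I_n j.
Proof. by rewrite /mx_edge; case: insubP => // ? ? _; case: insubP. Qed.

Lemma mx_fin_out i : finite_set [set j | mx_edge i j != 0%N].
Proof. by apply: (sub_finite_set _ (finite_II n)) => j /mx_edge_vert[]. Qed.

Lemma mx_fin_in i : finite_set [set j | mx_edge j i != 0%N].
Proof. by apply: (sub_finite_set _ (finite_II n)) => j /mx_edge_vert[]. Qed.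

Definition rooted_at (i : 'I_n) : rmgraph :=
  @RMGraph `I_n mx_edge i (outdeg mx_edge) (ltn_ord i) mx_edge_vert
    mx_fin_out mx_fin_in (fun _ _ => leqnn _).

Definition mx_outdeg (j : 'I_n) : nat := (\sum_i e j i)%N.

Lemma outdeg_mx_edge (j : 'I_n) : outdeg mx_edge j = mx_outdeg j.
Proof.
rewrite /outdeg -(fsbig_widen `I_n setT)//=; last first.
  move=> i [_ /= ni]; apply/eqP/negPn/negP => /mx_edge_vert[_]; exact: ni.
rewrite -fsbig_ord; apply: eq_bigr => i _; exact: mx_edge_ord.
Qed.

(* As 0^-1 = 0, the terms with out-degree 0 vanish. *)
Definition is_pagerank (R : realType) (c : R) (r : 'I_n -> R) : Prop :=
  forall i, r i =
    c * (\sum_j (e j i)%:R / (mx_outdeg j)%:R * r j) + (1 - c).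

Lemma pagerank_exists_unique (R : realType) (c : R) : 0 < c < 1 ->
  exists! r : 'rV[R]_n, is_pagerank c (r ord0).
Proof.
move=> /andP[c0 c1].
pose B : 'M[R]_n := \matrix_(j, i) ((e j i)%:R / (mx_outdeg j)%:R).
pose M : 'M[R]_n := 1%:M - c *: B.
have B_ge0 j i : 0 <= B j i by rewrite mxE divr_ge0.
have B_le1 j : \sum_i B j i <= 1.
  under eq_bigr do rewrite mxE.
  rewrite -mulr_suml -natr_sum -/(mx_outdeg j).
  have [->|j0] := eqVneq (mx_outdeg j) 0%N; first by rewrite mul0r.
  by rewrite divff// pnatr_eq0.
have Mfree : row_free M.
  apply: inj_row_free => u; rewrite mulmxBr mulmx1 -scalemxAr => /eqP.
  rewrite subr_eq0 => /eqP uE.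
  have uB i : `|u ord0 i| <= c * \sum_j `|u ord0 j| * B j i.
    rewrite {1}uE !mxE normrM gtr0_norm// ler_pM2l//.
    rewrite (le_trans (ler_norm_sum _ _ _))//; apply: ler_sum => j _.
    by rewrite normrM (ger0_norm (B_ge0 _ _)).
  pose S := \sum_i `|u ord0 i|.
  have S_le : S <= c * S.
    rewrite (le_trans (ler_sum _ (fun i _ => uB i)))// -mulr_sumr ler_pM2l//.
    rewrite exchange_big/=; apply: ler_sum => j _.
    by rewrite -mulr_sumr ler_piMr.
  have S0 : S = 0.
    apply/eqP; rewrite eq_le sumr_ge0// andbT -(pmulr_rle0 _ (_ : 0 < 1 - c)).
      by rewrite mulrBl mul1r subr_le0.
    by rewrite subr_gt0.
  apply/rowP => i; rewrite mxE; apply/eqP; rewrite -normr_eq0.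
  by move/eqP: S0; rewrite psumr_eq0// => /allP/(_ i (mem_index_enum _)).
have Munit : M \in unitmx by rewrite -row_free_unit.
have prE (r : 'rV[R]_n) :
    is_pagerank c (r ord0) <-> r *m M = const_mx (1 - c).
  rewrite mulmxBr mulmx1 -scalemxAr.
  have rB i : (c *: (r *m B)) ord0 i =
      c * (\sum_j (e j i)%:R / (mx_outdeg j)%:R * r ord0 j).
    by rewrite !mxE; congr (_ * _); apply: eq_bigr => j _; rewrite mxE mulrC.
  split => [rE|rE i].
    apply/rowP => i; rewrite mxE [X in _ + X]mxE rB [RHS]mxE {1}rE.
    by rewrite addrAC subrr add0r.
  have /rowP/(_ i) := rE; rewrite mxE [X in _ + X]mxE rB [RHS]mxE => <-.
  by rewrite addrCA subrr addr0.
exists (const_mx (1 - c) *m invmx M); split.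
  by apply/prE; rewrite mulmxKV.
by move=> r /prE <-; rewrite mulmxK.
Qed.

End finite_graph.

HB.instance Definition _ (R : realType) := isPointed.Build (lwspace R)
  (lwclass R (rooted_at (0 : 'M[nat]_1) ord0)).

(* A map into a countable set, seen as a discrete measurable space, is a random
   variable exactly when its fibers are measurable. *)
Definition discrete_rv d (T : measurableType d) (U : Type) (X : T -> U) : Prop :=
  forall u, measurable (X @^-1` [set u]).

Section convergence.
Variables (R : realType) (d : nat -> measure_display).
Variables (T : forall n, measurableType (d n)).
Variables (P : forall n, probability (T n) R).
Local Open Scope ereal_scope.

Definition cvg_in_probability (X : forall n, T n -> R) (l : R) : Prop :=
  forall eps : R, (0 < eps)%R ->
    P n [set w | (eps <= `|X n w - l|)%R] @[n --> \oo] --> 0.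

Definition cvg_in_distribution (X : forall n, T n -> R)
    d' (T' : measurableType d') (Q : probability T' R) (Y : {RV Q >-> R}) : Prop :=
  forall x : R, {for x, continuous (cdf Y)} ->
    P n [set w | (X n w <= x)%R] @[n --> \oo] --> cdf Y x.

End convergence.

(* The random vertex V is uniform on the n vertices, conditionally on G. *)
Definition uniform_given (R : realType) d (T : measurableType d)
    (P : probability T R) n (G : T -> 'M[nat]_n) (V : T -> 'I_n) : Prop :=
  discrete_rv V /\
  forall g i, (P (G @^-1` [set g] `&` V @^-1` [set i]) =
               (n%:R^-1)%:E * P (G @^-1` [set g]))%E.

Section lw_convergence.
Variable R : realType.

Definition lwborel := g_sigma_algebraType (@open (lwspace R)).

(* mscale and msum express (n.+1)^-1 times the sum of the Dirac masses at the
   n.+1 rootings of e; inord k runs over all vertices as k < n.+1. *)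
Definition empirical n (e : 'M[nat]_n.+1) : {measure set lwborel -> \bar R} :=
  mscale (n.+1%:R^-1)%:nng
    (msum (fun k => \d_(lwclass R (rooted_at e (inord k)) : lwborel)) n.+1).

Definition lwmean n (e : 'M[nat]_n.+1) (f : lwspace R -> R) : R :=
  \int[empirical e]_x f x.

Variables (d : nat -> measure_display) (T : forall n, measurableType (d n)).
Variables (P : forall n, probability (T n) R).
Variable G : forall n, T n -> 'M[nat]_n.+1.
Variable mu : probability lwborel R.

Definition lw_cvg_in_distribution : Prop :=
  forall f : lwspace R -> R, continuous f -> bounded_fun f ->
    ('E_(P n)[fun w => lwmean (G w) f] @[n --> \oo] --> 'E_mu[f])%E.

Definition lw_cvg_in_probability : Prop :=
  forall f : lwspace R -> R, continuous f -> bounded_fun f ->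
    cvg_in_probability P (fun n w => lwmean (G w) f) (\int[mu]_x f x).

End lw_convergence.

(* Main.v *)
From HB Require Import structures.
Require Import Defs.
From mathcomp Require Import all_boot all_order all_algebra.
From mathcomp Require Import all_classical all_reals all_analysis.
From mathcomp Require Import measurable_realfun lra.

(** PageRank is an infinite sum over the directed paths ending at a vertex, and
    a path of length l carries weight at most c ^ l.  Truncating the
    sum at length N gives a quantity that depends only on the N-neighborhood of
    the vertex and on the marks (partial_rank_nbhd), hence a locally constant
    function on the local weak space, whose level sets have continuous
    indicators.  Local weak convergence therefore controls the proportion of
    vertices whose truncated rank exceeds a given level.

    In a finite graph with n vertices the truncated rank increases with N, stays
    below the PageRank (power_iter_le), and the total error is at most c ^ N n
    (power_iter_dist), uniformly over all graphs.  By Markov's inequality, the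
    proportion of vertices with PageRank above x lies between the proportion
    with truncated rank above x and, for every y < x, the proportion with
    truncated rank above y plus c ^ N / (x - y) (proportion_ge_local,
    proportion_le_local).

    The limiting variable is the supremum over N of the truncated ranks, under
    the limiting measure.  Average PageRank is at most 1 in finite graphs
    (pagerank_sum_le); passing to the limit with the bounded continuous capped
    truncated ranks and using monotone convergence, the supremum has mean at
    most 1 and is almost surely finite.  At a continuity point x of its
    distribution function, one takes y close to x and then N large
    (tail_approximation), and both modes of convergence follow from the
    comparison above. *)

Set Implicit Arguments.
Unset Strict Implicit.
Unset Printing Implicit Defensive.

Import Order.TTheory GRing.Theory Num.Theory.
Import numFieldNormedType.Exports.

Local Open Scope classical_set_scope.
Local Open Scope ring_scope.

(** * Power iteration on rooted marked graphs *)

Section partial_rank.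
Variables (R : realType) (c : R).

(** The N-th power iterate started from the constant 1 - c: it is the part of
    the PageRank of x carried by the directed paths of length at most N that
    end at x.  Out-degrees are replaced by marks because a neighborhood keeps
    the marks of its vertices but may lose some of their outgoing edges. *)
Fixpoint partial_rank (G : rmgraph) (N : nat) (x : nat) : R :=
  if N is N'.+1 then
    c * (\sum_(j \in rmg_vert G)
           (rmg_edge G j x)%:R / (rmg_mark G j)%:R * partial_rank G N' j)
    + (1 - c)
  else 1 - c.

Lemma partial_rank_iso G H phi :
    set_bij (rmg_vert G) (rmg_vert H) phi ->
    (forall i j, rmg_vert G i -> rmg_vert G j ->
      rmg_edge H (phi i) (phi j) = rmg_edge G i j) ->
    (forall i, rmg_vert G i -> rmg_mark H (phi i) = rmg_mark G i) ->
  forall N x, rmg_vert G x -> partial_rank H N (phi x) = partial_rank G N x.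
Proof.
move=> bij_phi edge_phi mark_phi; elim=> [//|N IHN] x Gx /=.
congr (_ * _ + _); rewrite (reindex_fsbig _ _ _ _ bij_phi)/=.
by apply: eq_fsbigr => j /set_mem Gj; rewrite edge_phi// mark_phi// IHN.
Qed.

(** The N-th iterate at x only explores the vertices from which x is reached in
    at most N steps.  If x is itself at distance size p from the root, all of
    them lie in the k-neighborhood as soon as size p + N <= k, which is why the
    induction is on N for an arbitrary path p. *)
Lemma partial_rank_nbhd G k N x p :
    path (fun i j => 0 < rmg_edge G i j)%N x p -> last x p = rmg_root G ->
    (size p + N <= k)%N ->
  partial_rank (nbhd G k) N x = partial_rank G N x.
Proof.
elim: N x p => [//|N IHN] x p xp px pNk /=.
have Ux : nbhd_vert G k x.
  by exists p; split => //; rewrite (leq_trans _ pNk)// leq_addr.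
have pathS j : (0 < rmg_edge G j x)%N ->
    path (fun i j => 0 < rmg_edge G i j)%N j (x :: p) by rewrite /= => ->.
have US j : (0 < rmg_edge G j x)%N -> nbhd_vert G k j.
  move=> jx; exists (x :: p); split; [exact: pathS|by []|].
  by rewrite (leq_trans _ pNk)//= addnS ltnS leq_addr.
congr (_ * _ + _).
rewrite -[RHS](fsbig_widen (nbhd_vert G k))//=; first last.
- move=> j [_ /= nUj]; case: (posnP (rmg_edge G j x)) => [->|/US//].
  by rewrite !mul0r.
- exact: nbhd_vert_sub.
apply: eq_fsbigr => j /set_mem Uj.
have k_gt0 : (0 < k)%N by rewrite (leq_trans _ pNk)// addnS.
rewrite /nbhd_edge k_gt0 (mem_set Uj) (mem_set Ux)/=.
case: (posnP (rmg_edge G j x)) => [->|jx]; first by rewrite !mul0r.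
by rewrite (IHN _ (x :: p))//=; [rewrite jx|rewrite addSnnS].
Qed.

Lemma partial_rank_root_iso G H k N : (N <= k)%N ->
    rmg_iso (nbhd G k) (nbhd H k) ->
  partial_rank G N (rmg_root G) = partial_rank H N (rmg_root H).
Proof.
move=> Nk [phi [bphi ephi rphi mphi]].
rewrite -(@partial_rank_nbhd G k N _ [::])// -(@partial_rank_nbhd H k N _ [::])//.
rewrite -(partial_rank_iso bphi ephi mphi _ (rmg_root_vert (nbhd G k))).
by rewrite rphi.
Qed.

Hypothesis c01 : 0 < c < 1.
Let c_ge0 : 0 <= c. Proof. by case/andP: c01 => /ltW. Qed.
Let subc_gt0 : 0 < 1 - c. Proof. by case/andP: c01 => _; rewrite subr_gt0. Qed.

Lemma partial_rank_ge0 G N x : 0 <= partial_rank G N x.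
Proof.
elim: N x => [|N IHN] x /=; first exact: ltW.
rewrite addr_ge0 ?(ltW subc_gt0)// mulr_ge0// fsumr_ge0// => j _.
by rewrite mulr_ge0// divr_ge0.
Qed.

(** Every further step adds the nonnegative contribution of longer paths. *)
Lemma partial_rank_homo G x : {homo (partial_rank G)^~ x : N M / (N <= M)%N >-> N <= M}.
Proof.
apply: (homo_leq (@lexx _ R) (@le_trans _ R)) => N.
elim: N x => [|N IHN] x.
  rewrite /= lerDr mulr_ge0// fsumr_ge0// => j _.
  by rewrite mulr_ge0 ?divr_ge0// ltW.
rewrite [in leRHS]/= [in leLHS]/= lerD2r ler_wpM2l//.
(* The sum over all vertices reduces to the finitely many in-neighbors of x. *)
have fin_in := rmg_fin_in G x.
have sub : [set j | rmg_edge G j x != 0%N] `<=` rmg_vert G.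
  by move=> j /= /rmg_edge_vert[].
rewrite -!(fsbig_widen _ _ _ sub); first last.
- by move=> j [_ /= /negP]; rewrite negbK => /eqP ->; rewrite !mul0r.
- by move=> j [_ /= /negP]; rewrite negbK => /eqP ->; rewrite !mul0r.
rewrite !(fsbig_finite _ _ fin_in); apply: ler_sum => j _.
by rewrite ler_wpM2l// divr_ge0.
Qed.

End partial_rank.

(** * Power iteration and PageRank on finite graphs *)

Section finite_graph.
Variables (R : realType) (c : R) (n : nat) (e : 'M[nat]_n).
Hypothesis c01 : 0 < c < 1.
Let c_ge0 : 0 <= c. Proof. by case/andP: c01 => /ltW. Qed.
Let subc_gt0 : 0 < 1 - c. Proof. by case/andP: c01 => _; rewrite subr_gt0. Qed.

Definition transition (j i : 'I_n) : R := (e j i)%:R / (mx_outdeg e j)%:R.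

Lemma transition_ge0 j i : 0 <= transition j i.
Proof. by rewrite divr_ge0. Qed.

Lemma transition_sum_le1 j : \sum_i transition j i <= 1.
Proof.
rewrite -mulr_suml -natr_sum -/(mx_outdeg e j).
have [->|j0] := eqVneq (mx_outdeg e j) 0%N; first by rewrite mul0r.
by rewrite divff// pnatr_eq0.
Qed.

(** The transition matrix is substochastic, rows of vertices without outgoing
    edges being zero, so that it cannot increase the total mass.  This is the
    source of all bounds below. *)
Lemma transition_contraction (u : 'I_n -> R) : (forall j, 0 <= u j) ->
  \sum_i \sum_j transition j i * u j <= \sum_j u j.
Proof.
move=> u_ge0; rewrite exchange_big/=; apply: ler_sum => j _.
by rewrite -mulr_suml ler_piMl// transition_sum_le1.
Qed.

Definition power_iter N (i : 'I_n) : R :=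
  partial_rank c (rooted_at e i) N i.

Lemma power_iterS N i : power_iter N.+1 i =
  c * (\sum_j transition j i * power_iter N j) + (1 - c).
Proof.
(* Changing the root does not change the iterate at a given vertex. *)
have root_irr M j k x : partial_rank c (rooted_at e j) M x =
    partial_rank c (rooted_at e k) M x.
  elim: M x => // M IHM x /=; congr (_ * _ + _).
  by apply: eq_fsbigr => l _; rewrite IHM.
rewrite /power_iter/=; congr (_ * _ + _); rewrite -fsbig_ord.
apply: eq_bigr => j _; rewrite mx_edge_ord outdeg_mx_edge.
by congr (_ * _); exact: root_irr.
Qed.

Variable r : 'I_n -> R.
Hypothesis hr : is_pagerank e c r.

Lemma pagerankE i : r i = c * (\sum_j transition j i * r j) + (1 - c).
Proof. exact: hr. Qed.

(** The negative part u of r satisfies u <= c B u with B substochastic, hence its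
    total mass S satisfies S <= c S and vanishes. *)
Lemma pagerank_ge0 i : 0 <= r i.
Proof.
pose u j := Num.max 0 (- r j).
have u_ge0 j : 0 <= u j by rewrite le_max lexx.
have u_le j : u j <= c * \sum_k transition k j * u k.
  rewrite ge_max mulr_ge0 ?sumr_ge0//=; last first.
    by move=> k _; rewrite mulr_ge0// transition_ge0.
  rewrite pagerankE opprD (le_trans (_ : _ <= - (c * (\sum_k transition k j * r k))))//.
    by rewrite gerDl oppr_le0 ltW.
  rewrite -mulrN ler_wpM2l// -sumrN; apply: ler_sum => k _.
  by rewrite -mulrN ler_wpM2l ?transition_ge0// le_max lexx orbT.
have S_le : \sum_j u j <= c * \sum_j u j.
  rewrite (le_trans (ler_sum _ (fun j _ => u_le j)))// -mulr_sumr ler_wpM2l//.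
  exact: transition_contraction.
have S0 : \sum_j u j = 0.
  apply/eqP; rewrite eq_le sumr_ge0// andbT -(pmulr_rle0 _ subc_gt0).
  by rewrite mulrBl mul1r subr_le0.
move/eqP: S0; rewrite psumr_eq0// => /allP/(_ i (mem_index_enum _)).
by move=> /= /eqP ui0; rewrite -oppr_le0 -ui0 le_max lexx orbT.
Qed.

(** Summing the PageRank equation gives S <= c S + (1 - c) n. *)
Lemma pagerank_sum_le : \sum_i r i <= n%:R.
Proof.
rewrite -subr_ge0 -(pmulr_rge0 _ subc_gt0) mulrBr subr_ge0 mulrBl mul1r.
rewrite lerBlDr {1}(eq_bigr _ (fun i _ => pagerankE i)) big_split/=.
rewrite sumr_const card_ord mulr_natr [leLHS]addrC.
rewrite lerD2l -mulr_sumr ler_wpM2l//.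
exact: transition_contraction pagerank_ge0.
Qed.

Lemma power_iter_le N i : power_iter N i <= r i.
Proof.
elim: N i => [|N IHN] i; rewrite pagerankE; last first.
  rewrite power_iterS lerD2r ler_wpM2l//; apply: ler_sum => j _.
  by rewrite ler_wpM2l ?transition_ge0.
rewrite /power_iter/= lerDr mulr_ge0// sumr_ge0// => j _.
by rewrite mulr_ge0 ?transition_ge0 ?pagerank_ge0.
Qed.

(** Each iteration contracts the l1 distance to the PageRank by a factor c.  The
    bound is uniform over all graphs with n vertices, which is what allows the
    limits in N and in n to be exchanged. *)
Lemma power_iter_dist N : \sum_i (r i - power_iter N i) <= c ^+ N * n%:R.
Proof.
elim: N => [|N IHN].
  rewrite expr0 mul1r (le_trans _ pagerank_sum_le)//.
  by apply: ler_sum => i _; rewrite gerBl ltW.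
rewrite exprS -mulrA (le_trans _ (ler_wpM2l c_ge0 IHN))//.
have ub_sum : \sum_i \sum_j transition j i * (r j - power_iter N j) <=
    \sum_i (r i - power_iter N i).
  by apply: transition_contraction => j; rewrite subr_ge0 power_iter_le.
apply: le_trans (ler_wpM2l c_ge0 ub_sum); rewrite mulr_sumr.
apply: ler_sum => i _; rewrite pagerankE power_iterS opprD addrACA subrr addr0.
rewrite -mulrBr -sumrB ler_wpM2l//; apply: ler_sum => j _.
by rewrite mulrBr.
Qed.

End finite_graph.

(** * Functions of a finite neighborhood *)

Lemma dloc_lt_iso (R : realType) (G H : rmgraph) k : (0 < k)%N ->
  dloc R G H < (1 + k%:R)^-1 -> rmg_iso (nbhd G k) (nbhd H k).
Proof.
move=> k_gt0; rewrite ltNge; apply: contraNP => niso.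
have dk : nbhd_differ G H k by apply/asboolP.
rewrite /dloc; case: pselect => [ex|[]]; last by exists k.
case: ex_minnP => m _ /(_ _ dk) mk.
by rewrite lef_pV2 ?posrE ?ltr_wpDr ?ler0n// lerD2l ler_nat.
Qed.

Section local_functions.
Variable R : realType.

(** Functions that only depend on a neighborhood of the root of some fixed
    radius.  They are constant on balls of a fixed radius, so all their level
    sets are both open and closed; in particular indicators of level sets are
    admissible test functions for local weak convergence. *)
Definition local_fun (U : Type) (f : lwspace R -> U) : Prop :=
  exists k, forall x y, lwdist x y < (1 + k%:R)^-1 -> f x = f y.

Lemma local_fun_comp (U W : Type) (g : U -> W) (f : lwspace R -> U) :
  local_fun f -> local_fun (g \o f).
Proof. by move=> [k fk]; exists k => x y /fk /= ->. Qed.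

Lemma local_fun_open (U : Type) (f : lwspace R -> U) (A : set U) :
  local_fun f -> open (f @^-1` A).
Proof.
move=> [k fk]; rewrite openE => x /= Afx; apply/nbhs_ballP.
exists (1 + k%:R)^-1; first by rewrite /= invr_gt0 ltr_wpDr.
by move=> y; rewrite ballEmdist /= => /fk <-.
Qed.

Lemma local_fun_continuous (f : lwspace R -> R) : local_fun f -> continuous f.
Proof.
move=> /local_fun_open fo; apply/continuousP => A _; exact: fo.
Qed.

Lemma local_fun_measurable_preimage (U : Type) (f : lwspace R -> U) (A : set U) :
  local_fun f -> measurable (f @^-1` A : set (lwborel R)).
Proof. by move=> lf; apply: sub_sigma_algebra; exact: local_fun_open. Qed.

Lemma local_fun_measurable (f : lwspace R -> R) :
  local_fun f -> measurable_fun [set: lwborel R] (f : lwborel R -> R).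
Proof.
by move=> lf _ B _; rewrite setTI; exact: local_fun_measurable_preimage.
Qed.

Lemma lwmean_local n (e : 'M[nat]_n.+1) (f : lwspace R -> R) : local_fun f ->
    (forall x, 0 <= f x) ->
  lwmean e f = n.+1%:R^-1 * \sum_(i < n.+1) f (lwclass R (rooted_at e i)).
Proof.
move=> lf f_ge0; have mf := local_fun_measurable lf.
have mEf : measurable_fun [set: lwborel R] (fun z : lwborel R => (f z)%:E).
  exact/measurable_EFinP.
rewrite /lwmean /Rintegral /empirical ge0_integral_mscale//; last first.
  by move=> x _ /=; rewrite lee_fin.
rewrite ge0_integral_measure_sum//; last by move=> x _ /=; rewrite lee_fin.
under eq_bigr => i _ do rewrite integral_dirac// diracT mul1e inord_val.
by rewrite sumEFin.
Qed.

End local_functions.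

(** * The truncated rank as a function on the local weak space *)

Section local_rank.
Variables (R : realType) (c : R).

Definition local_rank N (z : lwspace R) : R :=
  partial_rank c (lwrepr z) N (rmg_root (lwrepr z)).

Lemma local_rank_local N : local_fun (local_rank N).
Proof.
exists N.+1 => x y /dloc_lt_iso iso_xy.
by apply: partial_rank_root_iso (iso_xy _).
Qed.

(** The chosen representative of the class of a finite graph is only known to
    have the same neighborhoods, which suffices by locality. *)
Lemma local_rank_rooted_at n (e : 'M[nat]_n) N i :
  local_rank N (lwclass R (rooted_at e i)) = power_iter c e N i.
Proof.
rewrite /local_rank; set z := lwclass _ _.
have : dloc R (lwrepr z) (rooted_at e i) = 0 by apply/lwclassP; rewrite lwreprK.
move=> d0; apply: (@partial_rank_root_iso _ _ _ _ N.+1) => //.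
by apply: (@dloc_lt_iso R); rewrite // d0 invr_gt0 ltr_wpDr.
Qed.

Hypothesis c01 : 0 < c < 1.

Lemma local_rank_ge0 N z : 0 <= local_rank N z.
Proof. exact: partial_rank_ge0. Qed.

Lemma local_rank_homo z : {homo local_rank^~ z : N M / (N <= M)%N >-> N <= M}.
Proof. exact: partial_rank_homo. Qed.

Definition rank_gt N x : set (lwborel R) := [set z | x < local_rank N z].

Lemma indic_rank_gtE N x z :
  \1_(rank_gt N x) z = (x < local_rank N z)%R%:R :> R.
Proof. by rewrite indicE; congr (nat_of_bool _)%:R; apply/idP/idP; rewrite inE. Qed.

Lemma indic_rank_gt_local N x : local_fun (\1_(rank_gt N x) : lwspace R -> R).
Proof.
rewrite (_ : \1__ = (fun y => (x < y)%R%:R) \o local_rank N); last first.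
  by apply/funext => z; rewrite indic_rank_gtE.
by apply: local_fun_comp; exact: local_rank_local.
Qed.

Lemma indic_rank_gt_bounded N x : bounded_fun (\1_(rank_gt N x) : lwspace R -> R).
Proof.
exists 1; split; first exact: num_real.
by move=> M /ltW M1 z _ /=; rewrite indic_rank_gtE ger0_norm// (le_trans _ M1)// lern1 leq_b1.
Qed.

Lemma measurable_rank_gt N x : measurable (rank_gt N x).
Proof.
exact: (@local_fun_measurable_preimage R _ _ [set y | x < y] (local_rank_local N)).
Qed.

Lemma lwmean_rank_gt n (e : 'M[nat]_n.+1) N x :
  lwmean e (\1_(rank_gt N x)) =
  n.+1%:R^-1 * \sum_i (x < power_iter c e N i)%R%:R.
Proof.
rewrite lwmean_local; [|exact: indic_rank_gt_local|by []].
by under eq_bigr do rewrite indic_rank_gtE local_rank_rooted_at.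
Qed.

(** The truncated rank is unbounded; capping it gives a bounded test function
    from which the bound on the mean of the limit is obtained. *)
Definition capped_rank N (K : nat) (z : lwspace R) : R :=
  Num.min (local_rank N z) K%:R.

Lemma capped_rank_local N K : local_fun (capped_rank N K).
Proof. exact: (local_fun_comp (fun y => Num.min y K%:R) (local_rank_local N)). Qed.

Lemma capped_rank_ge0 N K z : 0 <= capped_rank N K z.
Proof. by rewrite le_min local_rank_ge0/=. Qed.

Lemma capped_rank_bounded N K : bounded_fun (capped_rank N K).
Proof.
exists K%:R; split; first exact: num_real.
move=> M /ltW KM z _ /=; rewrite ger0_norm ?capped_rank_ge0//.
by rewrite (le_trans _ KM)// ge_min lexx orbT.
Qed.

Lemma lwmean_capped_rank_le1 n (e : 'M[nat]_n.+1) (r : 'I_n.+1 -> R) N K :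
  is_pagerank e c r -> lwmean e (capped_rank N K) <= 1.
Proof.
move=> hr; rewrite lwmean_local; [|exact: capped_rank_local|exact: capped_rank_ge0].
rewrite mulrC ler_pdivrMr// mul1r (le_trans _ (pagerank_sum_le c01 hr))//.
apply: ler_sum => i _; rewrite (le_trans _ (power_iter_le c01 hr N i))//.
by rewrite -local_rank_rooted_at ge_min lexx.
Qed.

End local_rank.

(** * The limiting rank *)

Section limit_rank.
Variables (R : realType) (c : R).
Hypothesis c01 : 0 < c < 1.

Definition sup_rank (z : lwborel R) : \bar R :=
  ereal_sup (range (fun N => (local_rank c N z)%:E)).

(** On an arbitrary rooted graph the iterates may diverge; the value 0 given by
    fine in that case only matters on a null set, see sup_rank_finite_ae. *)
Definition limit_rank (z : lwborel R) : R := fine (sup_rank z).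

Lemma local_rank_le_sup N z : ((local_rank c N z)%:E <= sup_rank z)%E.
Proof. by apply: ereal_sup_ubound; exists N. Qed.

Lemma sup_rank_ge0 z : (0 <= sup_rank z)%E.
Proof. by rewrite (le_trans _ (local_rank_le_sup 0 z))// lee_fin local_rank_ge0. Qed.

Lemma limit_rank_ge0 z : 0 <= limit_rank z.
Proof. exact/fine_ge0/sup_rank_ge0. Qed.

Lemma capped_rank_homo (z : lwspace R) :
  {homo (fun N => (capped_rank c N N z)%:E) : N M / (N <= M)%N >-> (N <= M)%E}.
Proof.
move=> N M NM; rewrite lee_fin le_min !ge_min local_rank_homo//=.
by rewrite ler_nat NM orbT.
Qed.

(** Capping the N-th iterate at N itself yields an increasing sequence of bounded
    test functions with the same supremum as the iterates. *)
Lemma capped_rank_cvg (z : lwspace R) :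
  (capped_rank c N N z)%:E @[N --> \oo] --> sup_rank z.
Proof.
suff -> : sup_rank z = ereal_sup (range (fun N => (capped_rank c N N z)%:E)).
  exact: ereal_nondecreasing_cvgn (@capped_rank_homo z).
apply/eqP; rewrite eq_le; apply/andP; split; apply: ge_ereal_sup => _ [N _ <-].
  have [K /ltW K_ge] : exists K : nat, local_rank c N z < K%:R.
    by exists (Num.bound (local_rank c N z)); rewrite archi_boundP ?local_rank_ge0.
  apply: le_ereal_sup_tmp; exists (capped_rank c (maxn N K) (maxn N K) z)%:E.
    by exists (maxn N K).
  rewrite lee_fin le_min local_rank_homo ?leq_maxl//= (le_trans K_ge)//.
  by rewrite ler_nat leq_maxr.
apply: le_trans (local_rank_le_sup N z).
by rewrite lee_fin ge_min lexx.
Qed.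

Lemma measurable_capped_rank N K : measurable_fun [set: lwborel R]
  (fun z : lwborel R => (capped_rank c N K z)%:E).
Proof.
apply/measurable_EFinP; apply: local_fun_measurable; exact: capped_rank_local.
Qed.

Lemma measurable_sup_rank : measurable_fun [set: lwborel R] sup_rank.
Proof.
apply: (emeasurable_fun_cvg (fun N (z : lwborel R) => (capped_rank c N N z)%:E)).
  by move=> N; exact: measurable_capped_rank.
by move=> z _; exact: capped_rank_cvg.
Qed.

Lemma measurable_sup_rank_infty : measurable [set z | sup_rank z = +oo%E].
Proof.
rewrite -[X in measurable X]setTI.
exact: (measurable_sup_rank measurableT (emeasurable_set1 +oo%E)).
Qed.

Lemma measurable_limit_rank : measurable_fun [set: lwborel R] limit_rank.
Proof.
exact: measurableT_comp (fine_measurable _) measurable_sup_rank.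
Qed.

HB.instance Definition _ := isMeasurableFun.Build _ _ _ _ _ measurable_limit_rank.

Definition limit_rv (mu : probability (lwborel R) R) : {RV mu >-> R} := limit_rank.

Lemma sup_rank_gtE x : [set z | (x%:E < sup_rank z)%E] = \bigcup_N rank_gt c N x.
Proof.
apply/seteqP; split => z /=.
  by move=> /ereal_sup_gt[_ [N _ <-]]; rewrite lte_fin; exists N.
by move=> [N _ /= xN]; rewrite (lt_le_trans _ (local_rank_le_sup N z))// lte_fin.
Qed.

Variable mu : probability (lwborel R) R.
Hypothesis capped_rank_le1 :
  forall N K, (\int[mu]_z (capped_rank c N K z)%:E <= 1)%E.

(** Monotone convergence along the capped iterates. *)
Lemma integral_sup_rank_le1 : (\int[mu]_z sup_rank z <= 1)%E.
Proof.
pose g N (z : lwborel R) := (capped_rank c N N z)%:E.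
have mg N : measurable_fun [set: lwborel R] (g N) by exact: measurable_capped_rank.
have g_ge0 N (z : lwborel R) : [set: lwborel R] z -> (0 <= g N z)%E.
  by move=> _; rewrite lee_fin capped_rank_ge0.
have ndg (z : lwborel R) : [set: lwborel R] z ->
    {homo g^~ z : N M / (N <= M)%N >-> (N <= M)%E}.
  by move=> _; exact: capped_rank_homo.
have limg : (fun z => limn (g^~ z)) = sup_rank.
  by apply/funext => z; apply/cvg_lim => //; exact: capped_rank_cvg.
have := cvg_monotone_convergence (mu := mu) measurableT mg g_ge0 ndg.
rewrite limg => cvg_int; rewrite -(cvg_lim _ cvg_int)//; apply: lime_le.
  by apply/cvg_ex; exists (\int[mu]_x sup_rank x)%E.
by near=> N; exact: capped_rank_le1.
Unshelve. all: by end_near. Qed.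

Lemma expectation_limit_rank_le1 : ('E_mu[limit_rv mu] <= 1)%E.
Proof.
rewrite unlock; apply: le_trans integral_sup_rank_le1.
apply: ge0_le_integral => //=.
- by move=> z _; rewrite lee_fin limit_rank_ge0.
- by apply/measurable_EFinP; exact: measurable_limit_rank.
- exact: measurable_sup_rank.
- move=> z _; rewrite /limit_rank; have := sup_rank_ge0 z.
  by case: (sup_rank z) => //= _; rewrite leey.
Qed.

Lemma sup_rank_finite_ae : mu [set z | sup_rank z = +oo%E] = 0%E.
Proof.
have isup : mu.-integrable [set: lwborel R] sup_rank.
  apply/integrableP; split; first exact: measurable_sup_rank.
  under eq_integral => z _ do rewrite gee0_abs ?sup_rank_ge0//.
  by rewrite (le_lt_trans integral_sup_rank_le1)// ltry.
have /(integrable_ae measurableT)[B [mB muB sB]] := isup.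
apply/eqP; rewrite -measure_le0 -muB le_measure ?inE//;
  first exact: measurable_sup_rank_infty.
by move=> z /= zoo; apply: sB => /(_ I); rewrite zoo.
Qed.

Lemma measurable_limit_rank_gt x : measurable [set z | x < limit_rank z].
Proof.
have := measurable_limit_rank measurableT (measurable_itv `]x, +oo[).
rewrite setTI; congr (measurable _); apply/seteqP.
by split => z /=; rewrite in_itv/= andbT.
Qed.

(** The two events only differ where the iterates diverge. *)
Lemma limit_rank_tailE x :
  mu [set z | x < limit_rank z] = mu (\bigcup_N rank_gt c N x).
Proof.
set Z := [set z | sup_rank z = +oo%E].
have mZ : measurable Z := measurable_sup_rank_infty.
have mB : measurable (\bigcup_N rank_gt c N x).
  by apply: bigcupT_measurable => N; exact: measurable_rank_gt.
rewrite -(measureU0 (measurable_limit_rank_gt x) mZ sup_rank_finite_ae).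
rewrite -(measureU0 mB mZ sup_rank_finite_ae); congr (mu _).
rewrite -sup_rank_gtE; apply/seteqP; split => z; rewrite /Z /limit_rank /=;
  have := sup_rank_ge0 z; case: (sup_rank z) => [s _|_|//]; rewrite ?lte_fin//=;
  by right.
Qed.

Definition tail x : R := fine (mu [set z | x < limit_rank z]).

Lemma rank_gt_homo x : {homo rank_gt c ^~ x : N M / (N <= M)%N >-> (N <= M)%O}.
Proof.
move=> N M NM; apply/subsetPset => z /lt_le_trans; apply.
exact: local_rank_homo.
Qed.

Lemma rank_gt_tail N x : fine (mu (rank_gt c N x)) <= tail x.
Proof.
have mB : measurable (\bigcup_N rank_gt c N x).
  by apply: bigcupT_measurable => M; exact: measurable_rank_gt.
apply: fine_le; rewrite ?fin_num_measure//.
- exact: measurable_rank_gt.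
- exact: measurable_limit_rank_gt.
rewrite limit_rank_tailE le_measure ?inE//; first exact: measurable_rank_gt.
by move=> z; exists N.
Qed.

Lemma rank_gt_cvg x : fine (mu (rank_gt c N x)) @[N --> \oo] --> tail x.
Proof.
have mB : measurable (\bigcup_N rank_gt c N x).
  by apply: bigcupT_measurable => N; exact: measurable_rank_gt.
have : mu (rank_gt c N x) @[N --> \oo] --> (tail x)%:E.
  rewrite /tail fineK; last first.
    by rewrite fin_num_measure//; exact: measurable_limit_rank_gt.
  rewrite limit_rank_tailE.
  apply: nondecreasing_cvg_mu => //; last exact: rank_gt_homo.
  by move=> N; exact: measurable_rank_gt.
by move=> /fine_cvgP[_].
Qed.

Lemma cdf_limit_rvE x : cdf (limit_rv mu) x = (1 - tail x)%:E.
Proof.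
have mA := measurable_limit_rank_gt x.
have -> : cdf (limit_rv mu) x = mu (~` [set z | x < limit_rank z]).
  congr (mu _); apply/seteqP; split => z /=; rewrite in_itv/=.
    by move=> zx; apply/negP; rewrite -leNgt.
  by move/negP; rewrite -leNgt.
by rewrite probability_setC// EFinB fineK// fin_num_measure.
Qed.

Lemma tail_continuous x : {for x, continuous (cdf (limit_rv mu))} ->
  {for x, continuous tail}.
Proof.
rewrite /prop_for /continuous_at cdf_limit_rvE => /fine_cvgP[_ cvg_fine].
have -> : tail = fun y => 1 - (fine \o cdf (limit_rv mu)) y.
  by apply/funext => y /=; rewrite cdf_limit_rvE/= opprB addrCA subrr addr0.
apply: cvgB; first exact: cvg_cst.
by rewrite /= cdf_limit_rvE.
Qed.

(** At a continuity point x the tail of the limiting rank is caught between two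
    test probabilities.  The point y is moved slightly below x first, at a cost
    controlled by continuity; only then is N taken large enough for both the
    lower bound and the error term c ^+ N / (x - y), which comes from
    proportion_le_local. *)
Lemma tail_approximation x (eta : R) :
    {for x, continuous (cdf (limit_rv mu))} -> 0 < eta ->
  exists N y, [/\ y < x, tail x - eta <= fine (mu (rank_gt c N x)) &
    fine (mu (rank_gt c N y)) + c ^+ N / (x - y) <= tail x + eta].
Proof.
move=> /tail_continuous cx eta_gt0.
have : \forall z \near x, `|tail x - tail z| < eta / 2.
  by apply: (cvgr_dist_lt _ _ (cx : tail z @[z --> x] --> tail x)); rewrite divr_gt0.
move=> /nbhs_ballP[d /= d_gt0 xd].
pose y := x - d / 2.
have yx : y < x by rewrite ltrBlDr ltrDl divr_gt0.
have xy_gt0 : 0 < x - y by rewrite subr_gt0.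
have ty : tail y <= tail x + eta / 2.
  have : `|tail x - tail y| < eta / 2.
    apply: xd; rewrite /ball/= opprB addrC subrK ger0_norm ?divr_ge0 ?ltW//.
    by rewrite ltr_pdivrMr// mulr_natr mulr2n ltrDl.
  by rewrite distrC => /ltW/ler_distlDr.
have /andP[c_gt0 c_lt1] := c01.
have cvg_cN : (c ^+ N / (x - y)) @[N --> \oo] --> 0 * (x - y)^-1.
  by apply: cvgMl; apply: cvg_expr; rewrite gtr0_norm.
have near1 : \forall N \near \oo, `|0 * (x - y)^-1 - c ^+ N / (x - y)| < eta / 2.
  by apply: (cvgr_dist_lt _ _ cvg_cN); rewrite divr_gt0.
have near2 : \forall N \near \oo, `|tail x - fine (mu (rank_gt c N x))| < eta.
  exact: (cvgr_dist_lt _ _ (@rank_gt_cvg x)).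
near \oo => N; exists N, y; split => //.
  have : `|tail x - fine (mu (rank_gt c N x))| < eta by near: N.
  by rewrite ltr_distlC => /andP[/ltW].
have : `|0 * (x - y)^-1 - c ^+ N / (x - y)| < eta / 2 by near: N.
rewrite mul0r sub0r normrN => /(le_lt_trans (ler_norm _)) cN.
rewrite (le_trans (lerD (rank_gt_tail N y) (ltW cN)))//.
by rewrite (le_trans (lerD ty (lexx _)))// -addrA -splitr.
Unshelve. all: by end_near. Qed.

End limit_rank.

(** * Comparing proportions of PageRank and of truncated rank *)

Section proportion.
Variables (R : realType) (c : R) (n : nat) (e : 'M[nat]_n.+1) (r : 'I_n.+1 -> R).
Hypotheses (c01 : 0 < c < 1) (hr : is_pagerank e c r).

Definition proportion (u : 'I_n.+1 -> R) (x : R) : R :=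
  n.+1%:R^-1 * \sum_i (x < u i)%R%:R.

Lemma proportion_ge0 u x : 0 <= proportion u x.
Proof. by rewrite mulr_ge0 ?invr_ge0 ?sumr_ge0. Qed.

Lemma proportion_ge_local N x : lwmean e (\1_(rank_gt c N x)) <= proportion r x.
Proof.
rewrite lwmean_rank_gt ler_wpM2l ?invr_ge0//; apply: ler_sum => i _.
case: (ltP x (power_iter c e N i)) => // xi.
by rewrite (lt_le_trans xi)// power_iter_le.
Qed.

(** A vertex with PageRank above x either has truncated rank above y or has a
    truncation error of at least x - y; Markov's inequality and power_iter_dist
    bound the proportion of the latter. *)
Lemma proportion_le_local N x y : y < x ->
  proportion r x <= lwmean e (\1_(rank_gt c N y)) + c ^+ N / (x - y).
Proof.
move=> yx; have xy_gt0 : 0 < x - y by rewrite subr_gt0.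
pose u := power_iter c e N.
have markov i : (x < r i)%R%:R <= (y < u i)%R%:R + (r i - u i) / (x - y) :> R.
  have ru : 0 <= r i - u i by rewrite subr_ge0 power_iter_le.
  case: (ltP x (r i)) => [xr|_]; last by rewrite addr_ge0// divr_ge0// ltW.
  case: (ltP y (u i)) => [_|uy]; first by rewrite lerDl divr_ge0// ltW.
  by rewrite add0r ler_pdivlMr// mul1r lerB// ltW.
rewrite lwmean_rank_gt /proportion.
rewrite (le_trans (ler_wpM2l _ (ler_sum _ (fun i _ => markov i)))) ?invr_ge0//.
rewrite big_split/= mulrDr lerD2l -mulr_suml mulrA ler_wpM2r ?invr_ge0 ?(ltW xy_gt0)//.
by rewrite mulrC ler_pdivrMr// power_iter_dist.
Qed.

End proportion.

(** * Random graphs and a uniform vertex *)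

Section discrete_rv.
Variables (R : realType) (d : measure_display) (T : measurableType d).

Lemma discrete_rv_preimage (U : countType) (X : T -> U) (A : set U) :
  discrete_rv X -> measurable (X @^-1` A).
Proof.
move=> mX; have -> : X @^-1` A = \bigcup_(u in A) X @^-1` [set u].
  by apply/seteqP; split => [w Aw|w [u Au /= ->//]]; exists (X w).
rewrite bigcup_mkcond; apply: countable_bigcupT_measurable => [|u].
  exact: countableP.
by case: ifP => _; [exact: mX|exact: measurable0].
Qed.

Lemma discrete_rv_comp (U : countType) (X : T -> U) (h : U -> R) :
  discrete_rv X -> measurable_fun setT (h \o X).
Proof. by move=> mX _ B _; rewrite setTI comp_preimage; exact: discrete_rv_preimage. Qed.

Variable P : probability T R.

(** Functions of a random variable with values in a countable type are always
    measurable, so that pointwise bounds pass to expectations. *)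
Lemma discrete_expectation_le (U : countType) (X : T -> U) (f g : U -> R) (k : R) :
    discrete_rv X -> (forall u, 0 <= f u) -> (forall u, 0 <= g u) -> 0 <= k ->
    (forall u, f u <= g u + k) ->
  ('E_P[f \o X] <= 'E_P[g \o X] + k%:E)%E.
Proof.
move=> mX f0 g0 k0 fg; rewrite unlock.
have mE (h : U -> R) : measurable_fun setT (fun w => (h (X w))%:E : \bar R).
  by apply/measurable_EFinP; exact: discrete_rv_comp.
have -> : (k%:E = \int[P]_w (k%:E : \bar R))%E.
  by rewrite integral_cst// -[LHS]mule1; congr (_ * _)%E; exact/esym/probability_setT.
rewrite -ge0_integralD//; [|by move=> w _; rewrite lee_fin /=|exact: mE].
apply: ge0_le_integral => //.
- by move=> w _; rewrite lee_fin /=.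
- exact: mE.
- exact: (mE (fun u => g u + k)).
- by move=> w _; rewrite -EFinD lee_fin /=.
Qed.

(** The defining property of a uniform vertex concerns single graphs; it extends
    to events by countable additivity, as there are countably many graphs. *)
Lemma uniform_given_event n (G : T -> 'M[nat]_n) (V : T -> 'I_n) A i :
    discrete_rv G -> uniform_given P G V ->
  (P (G @^-1` A `&` V @^-1` [set i]) = (n%:R^-1)%:E * P (G @^-1` A))%E.
Proof.
move=> mG [mV GV].
(* Slices containing at most one graph, numbered by pickle. *)
pose F k := [set g : 'M[nat]_n | A g /\ pickle g = k].
have GA : G @^-1` A = \bigcup_k G @^-1` F k.
  apply/seteqP; split => [w Aw|w [k _ []//]].
  by exists (pickle (G w)).
have tF : trivIset setT (fun k => G @^-1` F k).
  by move=> j k _ _ [w [[_ <-] [_ <-]]].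
have mF k : measurable (G @^-1` F k) by exact: discrete_rv_preimage.
have PF k : (P (G @^-1` F k `&` V @^-1` [set i]) =
    (n%:R^-1)%:E * P (G @^-1` F k))%E.
  have [[g Fg]|nF] := pselect (exists g, F k g); last first.
    have -> : G @^-1` F k = set0.
      by apply/seteqP; split => // w Fw; apply: nF; exists (G w).
    by rewrite set0I measure0 mule0.
  have -> : F k = [set g].
    apply/seteqP; split => [g' [_ g'k]|_ -> //].
    by case: Fg => _ gk; apply: (pcan_inj pickleK); rewrite gk g'k.
  exact: GV.
rewrite GA setI_bigcupl !measure_bigcup//; last first.
- exact: trivIset_setIr.
- by move=> k _; apply: measurableI => //; exact: mV.
rewrite (eq_eseriesr (fun k _ => PF k)).
by rewrite nneseriesZl.
Qed.

Lemma uniform_given_mean n (G : T -> 'M[nat]_n) (V : T -> 'I_n)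
    (B : 'M[nat]_n -> 'I_n -> bool) :
    discrete_rv G -> uniform_given P G V ->
  ('E_P[fun w => (n%:R^-1 * \sum_i (B (G w) i)%:R)%R] = P [set w | B (G w) (V w)])%E.
Proof.
move=> mG hV; have mV := hV.1.
have mB i : measurable [set w | B (G w) i].
  exact: (@discrete_rv_preimage _ _ [set g | B g i] mG).
have BE i w : (B (G w) i)%:R = \1_[set w' | B (G w') i] w :> R.
  by rewrite indicE; congr (nat_of_bool _)%:R; apply/idP/idP; rewrite inE.
rewrite unlock.
under eq_integral => w _.
  rewrite EFinM; under eq_bigr do rewrite BE.
  rewrite -sumEFin; over.
have mI i : measurable_fun setT (fun w => (\1_[set w' | B (G w') i] w)%:E : \bar R).
  by apply/measurable_EFinP; exact: measurable_indic.
rewrite ge0_integralZl//; first last.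
- by move=> w _; apply: sume_ge0 => i _; rewrite lee_fin.
- exact: emeasurable_sum.
rewrite ge0_integral_sum//.
under eq_bigr do rewrite integral_indic// setIT.
rewrite ge0_sume_distrr; last by [].
pose D i := [set w | B (G w) i] `&` V @^-1` [set i].
have -> : [set w | B (G w) (V w)] = \big[setU/set0]_(i < n) D i.
  rewrite -bigcup_seq; apply/seteqP; split => [w Bw|w].
    by exists (V w) => //=; rewrite mem_index_enum.
  by move=> [i _ [/= + Vi]]; rewrite Vi.
rewrite measure_bigsetU_ord//.
- by apply: eq_bigr => i _; exact: esym (uniform_given_event [set g | B g i] i mG hV).
- by move=> i; apply: measurableI => //; exact: mV.
- by move=> i j _ _ [w [[_ <-] [_ <-]]].
Qed.

End discrete_rv.

(** * Convergence along the sequence of random graphs *)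

Section pagerank_vector.
Variables (R : realType) (c : R) (n : nat).
Hypothesis c01 : 0 < c < 1.

Definition pagerank_vector (e : 'M[nat]_n) : 'I_n -> R :=
  sval (cid (pagerank_exists_unique e c01)) ord0.

Lemma pagerank_vectorP e : is_pagerank e c (pagerank_vector e).
Proof. by rewrite /pagerank_vector; case: cid => v [] /=. Qed.

Lemma pagerank_vector_unique e r : is_pagerank e c r -> r = pagerank_vector e.
Proof.
move=> hr; rewrite /pagerank_vector; case: cid => v [_ v_unique] /=.
have rowE : (\row_i r i) ord0 = r by apply/funext => i; rewrite mxE.
by rewrite (v_unique (\row_i r i)) rowE.
Qed.

End pagerank_vector.

Section pagerank_sequence.
Variables (R : realType) (c : R).
Hypothesis c01 : 0 < c < 1.
Variables (d : nat -> measure_display) (T : forall n, measurableType (d n)).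
Variables (P : forall n, probability (T n) R).
Variables (G : forall n, T n -> 'M[nat]_n.+1).
Hypothesis mG : forall n, discrete_rv (@G n).
Variables (rho : forall n, 'M[nat]_n.+1 -> 'I_n.+1 -> R).
Hypothesis hrho : forall n e, is_pagerank e c (@rho n e).
Variable mu : probability (lwborel R) R.

Lemma integral_capped_rank_fin_num N K :
  (\int[mu]_z (capped_rank c N K z)%:E)%E \is a fin_num.
Proof.
rewrite fin_numElt (lt_le_trans (ltNyr 0)); last first.
  by apply: integral_ge0 => z _; rewrite lee_fin capped_rank_ge0.
apply: (@le_lt_trans _ _ K%:R%:E); last exact: ltry.
have -> : (K%:R%:E = \int[mu]_z (K%:R%:E : \bar R))%E.
  by rewrite integral_cst// -[LHS]mule1; congr (_ * _)%E; exact/esym/probability_setT.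
apply: ge0_le_integral => //.
- by move=> z _; rewrite lee_fin capped_rank_ge0.
- exact: measurable_capped_rank.
- by move=> z _; rewrite lee_fin ge_min lexx orbT.
Qed.

(** In a finite graph the truncated rank is below the PageRank, whose average is
    at most 1; the limiting mean of the capped rank inherits the bound. *)
Lemma in_distribution_capped_rank_le1 : lw_cvg_in_distribution P G mu ->
  forall N K, (\int[mu]_z (capped_rank c N K z)%:E <= 1)%E.
Proof.
move=> cvgG N K.
have := cvgG _ (local_fun_continuous (capped_rank_local c N K)) (capped_rank_bounded c01 N K).
have -> : ('E_mu[capped_rank c N K] = \int[mu]_z (capped_rank c N K z)%:E)%E.
  by rewrite unlock.
apply: cvge_le; near=> n.
have -> : (1 = \int[P n]_w (1 : \bar R))%E.
  by rewrite integral_cst// mul1e; exact/esym/probability_setT.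
rewrite unlock; apply: ge0_le_integral => //.
- move=> w _; rewrite lee_fin Rintegral_ge0// => z _.
  exact: capped_rank_ge0.
- apply/measurable_EFinP.
  exact: (discrete_rv_comp (fun e => lwmean e (capped_rank c N K)) (@mG n)).
- by move=> w _; rewrite lee_fin (lwmean_capped_rank_le1 c01 _ _ (hrho _)).
Unshelve. all: by end_near. Qed.

(** If the limit exceeded 1, the deviation event for a suitable width would have
    probability 1 for every n. *)
Lemma in_probability_capped_rank_le1 : lw_cvg_in_probability P G mu ->
  forall N K, (\int[mu]_z (capped_rank c N K z)%:E <= 1)%E.
Proof.
move=> cvgG N K; rewrite leNgt; apply/negP => gt1.
pose l := \int[mu]_z capped_rank c N K z.
have l_gt1 : 1 < l.
  by rewrite -lte_fin /l /Rintegral fineK ?integral_capped_rank_fin_num.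
have l1_gt0 : 0 < l - 1 by rewrite subr_gt0.
have := cvgG _ (local_fun_continuous (capped_rank_local c N K))
  (capped_rank_bounded c01 N K) _ l1_gt0.
rewrite (_ : (fun n => _) = cst 1%E); last first.
  apply/funext => n; rewrite /cst -(probability_setT (P n)); congr (P n _).
  apply/seteqP; split => // w _ /=.
  rewrite distrC ler_normr lerD2l lerN2.
  by rewrite (lwmean_capped_rank_le1 c01 _ _ (hrho _)).
move=> /(cvg_lim (@ereal_hausdorff R)); rewrite lim_cst; last exact: ereal_hausdorff.
by move=> /eqP; rewrite onee_eq0.
Qed.

Local Notation X := (limit_rv c01 mu).

(** Averaging over a uniform vertex turns the probability that its rank exceeds x
    into the expected proportion of such vertices, to which the two-sided
    comparison with local test functions applies. *)
Lemma pagerank_cvg_in_distribution : lw_cvg_in_distribution P G mu ->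
  forall V : forall n, T n -> 'I_n.+1,
    (forall n, uniform_given (P n) (@G n) (@V n)) ->
  cvg_in_distribution P (fun n w => rho (G w) (V n w)) X.
Proof.
move=> cvgG V hV x cx.
have le1 := in_distribution_capped_rank_le1 cvgG.
pose p n := fine (P n [set w | x < rho (G w) (V n w)]).
have mp n : measurable [set w | x < rho (G w) (V n w)].
  have -> : [set w | x < rho (G w) (V n w)] =
      \bigcup_(i in [set: 'I_n.+1])
        (@G n @^-1` [set g | x < rho g i] `&` V n @^-1` [set i]).
    by apply/seteqP; split => [w xw|w [i _ [/= + Vi]]]; [exists (V n w)|rewrite Vi].
  apply: countable_bigcupT_measurable => [|i]; first exact: countableP.
  by apply: measurableI; [exact: discrete_rv_preimage|exact: (hV n).1].
have pE n : (p n)%:E = ('E_(P n)[fun w => proportion (rho (G w)) x])%E.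
  rewrite fineK ?fin_num_measure//; apply/esym.
  exact: (uniform_given_mean (fun g i => x < rho g i)%R (@mG n) (hV n)).
pose m n N y := fine ('E_(P n)[fun w => lwmean (G w) \1_(rank_gt c N y)])%E.
have cvg_m N y : (\forall n \near \oo,
     ('E_(P n)[fun w => lwmean (G w) \1_(rank_gt c N y)])%E \is a fin_num) /\
   (m n N y @[n --> \oo] --> fine (mu (rank_gt c N y))).
  apply/fine_cvgP; rewrite fineK ?fin_num_measure//; last exact: measurable_rank_gt.
  rewrite -expectation_indic; last exact: measurable_rank_gt.
  apply: cvgG; first exact/local_fun_continuous/indic_rank_gt_local.
  exact: indic_rank_gt_bounded.
have : p n @[n --> \oo] --> tail c mu x.
  apply/cvgrPdist_le => eps eps_gt0.
  have e2 : 0 < eps / 2 by rewrite divr_gt0.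
  have [N [y [yx lo hi]]] := tail_approximation le1 cx e2.
  have [finx cvgx] := cvg_m N x; have [finy cvgy] := cvg_m N y.
  move/cvgrPdist_le : cvgx => /(_ _ e2) nearx.
  move/cvgrPdist_le : cvgy => /(_ _ e2) neary.
  near=> n.
  have fx : ('E_(P n)[fun w => lwmean (G w) \1_(rank_gt c N x)])%E \is a fin_num.
    by near: n.
  have fy : ('E_(P n)[fun w => lwmean (G w) \1_(rank_gt c N y)])%E \is a fin_num.
    by near: n.
  have mp_le : m n N x <= p n.
    rewrite -lee_fin pE fineK// -[leRHS]adde0.
    apply: (@discrete_expectation_le _ _ _ (P n) _ _ (fun e => lwmean e \1_(rank_gt c N x))
      (fun e => proportion (rho e) x)) => // e.
    - by rewrite lwmean_rank_gt proportion_ge0.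
    - exact: proportion_ge0.
    - by rewrite addr0; exact: proportion_ge_local.
  have p_le : p n <= m n N y + c ^+ N / (x - y).
    rewrite -lee_fin pE EFinD fineK//.
    apply: (@discrete_expectation_le _ _ _ (P n) _ _ (fun e => proportion (rho e) x)
      (fun e => lwmean e \1_(rank_gt c N y))) => // [e|e||e].
    - exact: proportion_ge0.
    - by rewrite lwmean_rank_gt proportion_ge0.
    - by rewrite divr_ge0 ?exprn_ge0 ?subr_ge0// ltW//; case/andP: c01.
    - exact: proportion_le_local.
  have : `|fine (mu (rank_gt c N x)) - m n N x| <= eps / 2 by near: n.
  have : `|fine (mu (rank_gt c N y)) - m n N y| <= eps / 2 by near: n.
  rewrite !ler_distl => /andP[ay by_] /andP[ax bx].
  by apply/andP; split; lra.
move=> cvgp; rewrite cdf_limit_rvE.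
have -> : (fun n => P n [set w | rho (G w) (V n w) <= x]) = (fun n => (1 - p n)%:E).
  apply/funext => n.
  have -> : [set w | rho (G w) (V n w) <= x] = ~` [set w | x < rho (G w) (V n w)].
    apply/seteqP; split => w /=; first by move=> wx; apply/negP; rewrite -leNgt.
    by move/negP; rewrite -leNgt.
  by rewrite probability_setC// EFinB fineK// fin_num_measure.
apply: cvg_EFin; first by near=> n.
by apply: cvgB => //; exact: cvg_cst.
Unshelve. all: by end_near. Qed.

(** The comparison is deterministic, so a deviation of the proportion by eps forces
    a deviation by eps / 2 of one of two fixed test functions. *)
Lemma pagerank_proportion_cvg_in_probability : lw_cvg_in_probability P G mu ->
  forall x, {for x, continuous (cdf X)} ->
  cvg_in_probability P (fun n w => proportion (rho (G w)) x)
    (fine (mu [set w | x < X w])).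
Proof.
move=> cvgG x cx eps eps_gt0.
have le1 := in_probability_capped_rank_le1 cvgG.
have e2 : 0 < eps / 2 by rewrite divr_gt0.
have [N [y [yx lo hi]]] := tail_approximation le1 cx e2.
pose dev n z : set (T n) := [set w | eps / 2 <=
  `|lwmean (G w) \1_(rank_gt c N z) - fine (mu (rank_gt c N z))| ].
have cvg_dev z : P n (dev n z) @[n --> \oo] --> 0%E.
  have := cvgG _ (local_fun_continuous (indic_rank_gt_local c N z))
    (@indic_rank_gt_bounded _ c N z) _ e2.
  rewrite /Rintegral integral_indic ?setIT//; exact: measurable_rank_gt.
have mdev n z : measurable (dev n z).
  exact: (@discrete_rv_preimage _ _ _ (@G n) [set e | eps / 2 <=
    `|lwmean e \1_(rank_gt c N z) - fine (mu (rank_gt c N z))| ]).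
apply: (@squeeze_cvge _ _ _ _ (cst 0%E) _ (fun n => P n (dev n x) + P n (dev n y))%E).
- near=> n; rewrite measure_ge0/=.
  apply: le_trans (measureU2 _ (mdev n x) (mdev n y)).
  apply: le_measure; rewrite ?inE.
  + exact: (@discrete_rv_preimage _ _ _ (@G n) [set e | eps <=
      `|proportion (rho e) x - fine (mu [set w | x < X w])| ]).
  + exact: measurableU.
  + move=> w; rewrite /dev /= => dw; apply/orP; move: dw; apply: contraLR.
    rewrite negb_or -!ltNge !ltr_distl => /andP[/andP[ax bx] /andP[ay by_]].
    have lp := proportion_ge_local c01 (hrho (G w)) N x.
    have up := proportion_le_local c01 (hrho (G w)) N yx.
    rewrite /tail in lo hi.
    by apply/andP; split; lra.
- exact: cvg_cst.
- by rewrite -[X in _ --> X]adde0; apply: cvgeD.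
Unshelve. all: by end_near. Qed.

End pagerank_sequence.

(* The n-th graph of the sequence has n.+1 vertices.  In the second part x is a
   continuity point of the distribution of X: at an atom the proportion of
   vertices with PageRank larger than x need not converge. *)
Theorem theorem2p1 (R : realType) (c : R) (hc : 0 < c < 1)
    (d : nat -> measure_display) (T : forall n, measurableType (d n))
    (P : forall n, probability (T n) R)
    (G : forall n, T n -> 'M[nat]_n.+1) (mG : forall n, discrete_rv (G n))
    (r : forall n, T n -> 'I_n.+1 -> R)
    (hr : forall n w, is_pagerank (G n w) c (r n w)) :
  ((exists mu : probability (lwborel R) R, lw_cvg_in_distribution P G mu) ->
     exists d' (T' : measurableType d') (Q : probability T' R)
       (X : {RV Q >-> R}),
       [/\ forall w, 0 <= X w,
           ('E_Q[X] <= 1)%E &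
           forall V : forall n, T n -> 'I_n.+1,
             (forall n, uniform_given (P n) (G n) (V n)) ->
             cvg_in_distribution P (fun n w => r n w (V n w)) X])
  /\
  ((exists mu : probability (lwborel R) R, lw_cvg_in_probability P G mu) ->
     exists d' (T' : measurableType d') (Q : probability T' R)
       (X : {RV Q >-> R}),
       [/\ forall w, 0 <= X w,
           ('E_Q[X] <= 1)%E &
           forall x : R, 0 < x -> {for x, continuous (cdf X)} ->
             cvg_in_probability P
               (fun n w => n.+1%:R^-1 * \sum_i (x < r n w i)%R%:R)
               (fine (Q [set w | x < X w]))]).
Proof.
have -> : r = fun n w => pagerank_vector hc (G n w).
  apply/functional_extensionality_dep => n; apply/funext => w.
  exact: pagerank_vector_unique.
pose rho n : 'M[nat]_n.+1 -> 'I_n.+1 -> R := @pagerank_vector R c n.+1 hc.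
have hrho n e : is_pagerank e c (rho n e) by exact: pagerank_vectorP.
split => [[mu cvgG]|[mu cvgG]]; exists _, _, mu, (limit_rv hc mu); split.
- exact: limit_rank_ge0.
- exact: expectation_limit_rank_le1 (in_distribution_capped_rank_le1 hc mG hrho cvgG).
- by move=> V hV; exact: (pagerank_cvg_in_distribution mG hrho cvgG).
- exact: limit_rank_ge0.
- exact: expectation_limit_rank_le1 (in_probability_capped_rank_le1 hc hrho cvgG).
- by move=> x _ cx; exact: (pagerank_proportion_cvg_in_probability mG hrho cvgG).
Qed.
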